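(* Let $p$ be an odd prime and $b\in\{0,2,4,\ldots\}$. Then the function $$f(k)=\left(1-\left(\frac p3\right)p^{k(p-1)+b}\right)U_{k(p-1)+b}\qquad(k=0,1,2,\ldots)$$ is a $p$-regular function.
   Context: $[x]$ is the greatest integer not exceeding $x$. The sequence $\{U_n\}_{n\ge0}$ is defined by $U_0=1$ and $U_n=-2\sum_{k=1}^{[n/2]}\binom n{2k}U_{n-2k}$ for $n\ge1$. $\left(\frac p3\right)$ is the Legendre symbol: it equals $0$, $1$, $-1$ according as $p\equiv0,1,2\pmod3$. $\mathbb Z_p$ is the ring of rational numbers whose denominator is coprime to $p$. For a prime $p$, a function $f$ on the nonnegative integers is called $p$-regular if $f(k)\in\mathbb Z_p$ for $k=0,1,2,\ldots$ and $\sum_{k=0}^n\binom nk(-1)^kf(k)\equiv0\pmod{p^n}$ for all positive integers $n$. *)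

(* Defs.v *)
From mathcomp Require Import all_boot all_order all_algebra.

Set Implicit Arguments.
Unset Strict Implicit.
Unset Printing Implicit Defensive.

Import Order.TTheory GRing.Theory Num.Theory.
Local Open Scope ring_scope.

(* The list [:: U_n; U_(n-1); ...; U_0]. At stage n the tail s starts with     *)
(* U_(n-1), so U_(n-2k) is the entry of s at index 2k-1; see U_0 and U_rec     *)
(* below for the defining recurrence of U.                                     *)
Fixpoint U_list (n : nat) : seq int :=
  if n is n'.+1 then
    let s := U_list n' in
    (- 2 * \sum_(1 <= k < (n %/ 2).+1) ('C(n, 2 * k))%:Z * s`_(2 * k - 1)) :: s
  else [:: 1].

Definition U (n : nat) : int := head 0 (U_list n).

Lemma nth_U_list n i : (i <= n)%N -> (U_list n)`_i = U (n - i).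
Proof.
elim: n i => [|n IHn] [|i] //= le_in.
by rewrite IHn // subSS.
Qed.

Lemma U_0 : U 0 = 1.
Proof. by []. Qed.

Lemma U_rec n : (0 < n)%N ->
  U n = - 2 * \sum_(1 <= k < (n %/ 2).+1) ('C(n, 2 * k))%:Z * U (n - 2 * k).
Proof.
case: n => // n _; rewrite [LHS]/=; congr (_ * _).
apply: eq_big_nat => k /andP[k_gt0 k_le].
have le2k : (2 * k <= n.+1)%N.
  by rewrite mulnC -leq_divRL.
have e : (2 * k = (2 * k - 1).+1)%N by rewrite subn1 prednK ?muln_gt0.
rewrite nth_U_list; last by rewrite -ltnS -e.
by rewrite [in RHS]e subSS -e.
Qed.

(* The Legendre symbol (a / 3). *)
Definition legendre3 (a : nat) : int :=
  if (a %% 3 == 0)%N then 0 else if (a %% 3 == 1)%N then 1 else - 1.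

(* The rationals with denominator coprime to p (Z localized at (p), not the    *)
(* p-adic integers). [denq x] is the positive denominator in lowest terms.     *)
Definition Zloc (p : nat) : pred rat := [pred x | coprime `|denq x|%N p].

(* x and y are congruent modulo m in the ring Zloc p. *)
Definition Zloc_congr (p : nat) (m x y : rat) : Prop :=
  exists2 z : rat, z \in Zloc p & x - y = m * z.

Definition p_regular (p : nat) (f : nat -> rat) : Prop :=
  (forall k : nat, f k \in Zloc p) /\
  (forall n : nat, (0 < n)%N ->
     Zloc_congr p (p%:R ^+ n)
       (\sum_(0 <= k < n.+1) ('C(n, k))%:R * (- 1) ^+ k * f k) 0).

(* Main.v *)
(** Let [L] be the linear form on polynomials with [L 'X^n = U n].  The
    recurrence says [L (P(X + 1) + P(X - 1) - P(X)) = P(0)], so that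
    [L (P(X + a + 2)) + L (P(X + a - 1)) = P(a) + P(a + 1)].  Taking the
    alternating sum over [a = 1, 4, 7, ...] gives, for odd [M],
      [L P + L (P(X + 3M)) = \sum_(a < 3M) chi(a) P(a)]
    with [chi(a) = (-1)^(a+1) (a/3)] ([alt_legendre3 a]), hence [2 L P] is
    this sum modulo [M].
    Since [chi(p a) = (p/3) chi(a)], subtracting [(p/3)] times the congruence
    for [P(pX)] leaves only the terms with [a] prime to [p].  For
    [P = X^b (1 - X^(p-1))^n] these are divisible by [p^n] by Fermat's little
    theorem, while [L P - (p/3) L (P(pX))] is the alternating sum of the
    values of [f]. *)
From HB Require Import structures.
Require Import Defs.
From mathcomp Require Import all_boot all_order all_algebra.
From mathcomp Require Import cyclic ring zify.

Set Implicit Arguments.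
Unset Strict Implicit.
Unset Printing Implicit Defensive.

Import Order.TTheory GRing.Theory Num.Theory.
Local Open Scope ring_scope.

(** * The linear form attached to [U] *)

Definition umbral (P : {poly int}) : int := \sum_(i < size P) P`_i * U i.

(** Any common bound on the sizes will do, so several polynomials can be evaluated over one index
    range. *)
Lemma umbralE n (P : {poly int}) :
  (size P <= n)%N -> umbral P = \sum_(i < n) P`_i * U i.
Proof.
move=> le_Pn; rewrite /umbral (big_ord_widen n (fun i => P`_i * U i)) //.
rewrite big_mkcond /=; apply: eq_bigr => i _.
by case: ltnP => // le_Pi; rewrite nth_default ?mul0r.
Qed.

Lemma umbral_is_linear : scalar umbral.
Proof.
move=> c P Q; set n := maxn (size P) (size Q).
have leP : (size P <= n)%N by rewrite leq_maxl.
have leQ : (size Q <= n)%N by rewrite leq_maxr.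
have leS : (size (c *: P + Q)%R <= n)%N.
  rewrite (leq_trans (size_polyD _ _)) // geq_max leQ.
  by rewrite (leq_trans (size_scale_leq _ _)).
rewrite !(@umbralE n) // mulr_sumr -big_split /=; apply: eq_bigr => i _.
by rewrite coefD coefZ mulrDl mulrA.
Qed.

HB.instance Definition _ :=
  GRing.isLinear.Build int {poly int} int *%R umbral umbral_is_linear.

Lemma umbralXn n : umbral 'X^n = U n.
Proof.
rewrite /umbral size_polyXn big_ord_recr /= coefXn eqxx mul1r big1 ?add0r //.
by move=> i _; rewrite coefXn ltn_eqF ?mul0r // ltn_ord.
Qed.

Lemma sum_even_terms (R : nzRingType) n (F : nat -> R) :
  \sum_(i < n.+1) (1 + (-1) ^+ i) * F i
    = 2 * \sum_(0 <= k < (n %/ 2).+1) F (2 * k)%N.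
Proof.
elim: n => [|n IHn]; first by rewrite big_ord1 big_nat1 muln0 expr0.
rewrite big_ord_recr /= {}IHn -(signr_odd _ n.+1).
have [n1_odd | n1_even] := boolP (odd n.+1).
  by rewrite expr1 subrr mul0r addr0; congr (_ * \sum_(0 <= k < _) _); lia.
have -> : (n.+1 %/ 2 = (n %/ 2).+1)%N by lia.
by rewrite [in RHS]big_nat_recr //= mulrDr expr0; congr (_ + _ * F _); lia.
Qed.

(** By linearity take [P = 'X^n]. The odd powers of 1 and -1 cancel, and what remains is [2 * U n]
    from index 0 plus, for [n > 0], the sum that the recurrence equates with [- U n]. Hence the
    total is 0 for [n > 0], and 2 - 1 = 1 for [n = 0]. *)
Lemma umbral_shift2 (P : {poly int}) :
  umbral (P \Po ('X + 1)) + umbral (P \Po ('X - 1)) - umbral P = P.[0].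
Proof.
rewrite -[P]coefK poly_def.
apply: (big_ind (fun Q : {poly int} =>
  umbral (Q \Po ('X + 1)) + umbral (Q \Po ('X - 1)) - umbral Q = Q.[0])).
- by rewrite !comp_poly0 !linear0 horner0 addr0 subr0.
- move=> Q Q' EQ EQ'.
  by rewrite !comp_polyD !linearD /= hornerD -EQ -EQ'; ring.
move=> [n _] _ /=; rewrite !comp_polyZ !linearZ /= hornerZ -mulrDr -mulrBr.
congr (_ * _); rewrite hornerXn !comp_Xn_poly umbralXn.
rewrite !exprDn !linear_sum -big_split /=.
have termE i : umbral (('X ^+ (n - i) * 1 ^+ i) *+ 'C(n, i))
    + umbral (('X ^+ (n - i) * (- 1) ^+ i) *+ 'C(n, i))
    = (1 + (-1) ^+ i) * ('C(n, i)%:Z * U (n - i)).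
  rewrite expr1n mulr1 -(signr_odd {poly int}) -(signr_odd int).
  case: (odd i); rewrite ?expr0 ?expr1 ?mulr1 ?mulrN1 ?mulNrn ?linearN /=.
    by rewrite !subrr mul0r.
  rewrite linearMn /= umbralXn -mulr_natl natz; ring.
under eq_bigr => i _ do rewrite termE.
rewrite (@sum_even_terms _ _ (fun i => 'C(n, i)%:Z * U (n - i))) big_ltn //.
rewrite muln0 bin0 subn0 mul1r expr0n.
case: n {termE} => [|n]; first by rewrite big_geq // U_0.
by rewrite U_rec //=; ring.
Qed.

Lemma comp_poly_shift (P : {poly int}) (a c : int) :
  (P \Po ('X + a%:P)) \Po ('X + c%:P) = P \Po ('X + (a + c)%:P).
Proof.
by rewrite -comp_polyA comp_polyD comp_polyX comp_polyC polyCD addrAC addrA.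
Qed.

(** * Alternating character sums *)

Definition alt_legendre3 (a : nat) : int := (- 1) ^+ a.+1 * legendre3 a.

Lemma legendre3M a b : legendre3 (a * b) = legendre3 a * legendre3 b.
Proof.
rewrite /legendre3 -modnMm.
have: (a %% 3 < 3)%N by rewrite ltn_mod.
have: (b %% 3 < 3)%N by rewrite ltn_mod.
by case: (a %% 3)%N => [|[|[|?]]] //; case: (b %% 3)%N => [|[|[|?]]].
Qed.

Lemma alt_legendre3M p a : odd p ->
  alt_legendre3 (p * a) = legendre3 p * alt_legendre3 a.
Proof.
move=> p_odd; rewrite /alt_legendre3 legendre3M -signr_odd.
by rewrite -[in RHS]signr_odd /= oddM p_odd mulrCA.
Qed.

(** Adding the three-term relations centred at [a + 1] and [a + 2] cancels the two middle shifts. *)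
Lemma umbral_shift3 (P : {poly int}) (a : nat) :
  umbral (P \Po ('X + a%:Z%:P)) + umbral (P \Po ('X + (a + 3)%N%:Z%:P))
    = P.[a.+1%:Z] + P.[a.+2%:Z].
Proof.
have fun_eq (c : int) : umbral (P \Po ('X + (c + 1)%:P))
    + umbral (P \Po ('X + (c - 1)%:P)) - umbral (P \Po ('X + c%:P)) = P.[c].
  have := umbral_shift2 (P \Po ('X + c%:P)).
  rewrite horner_comp !hornerE -polyC1 -polyCN.
  by rewrite !comp_poly_shift.
rewrite -fun_eq -fun_eq.
have -> : a.+2%:Z + 1 = (a + 3)%N by lia.
have -> : a.+2%:Z - 1 = a.+1 by lia.
have -> : a.+1%:Z + 1 = a.+2 by lia.
have -> : a.+1%:Z - 1 = a by lia.
by ring.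
Qed.

(** The sum telescopes in blocks of three, each evaluated by [umbral_shift3]. *)
Lemma sum_alt_legendre3 (P : {poly int}) M :
  \sum_(0 <= a < 3 * M) alt_legendre3 a * P.[a%:Z]
    = umbral P - (- 1) ^+ M * umbral (P \Po ('X + (3 * M)%N%:Z%:P)).
Proof.
elim: M => [|M IHM].
  by rewrite muln0 big_geq // addr0 comp_polyXr expr0 mul1r subrr.
have -> : (3 * M.+1 = (3 * M + 3))%N by lia.
rewrite addnC; do 3 rewrite big_nat_recr //=.
rewrite {}IHM.
(* Since [3 * M] and [M] have the same parity, the block starting at [3 * M] carries the
   coefficients 0, 1, 1 times [(-1) ^+ M]. *)
have chi r : alt_legendre3 (r + 3 * M) = (- 1) ^+ (r + M).+1 * legendre3 r.
  rewrite /alt_legendre3 /legendre3 -modnDmr modnMr addn0.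
  by rewrite -signr_odd -[in RHS]signr_odd; congr ((-1) ^+ _ * _); lia.
rewrite (chi 0%N) (chi 1%N) (chi 2%N) /= /legendre3 /= mulr0 mul0r addr0 !mulr1.
have := umbral_shift3 P (3 * M); rewrite addnC => E.
have {}E : umbral (P \Po ('X + (3 + 3 * M)%N%:Z%:P)) =
    P.[(3 * M).+1%:Z] + P.[(3 * M).+2%:Z]
    - umbral (P \Po ('X + (3 * M)%N%:Z%:P)).
  by rewrite -E; ring.
by rewrite E !exprS; ring.
Qed.

(** * Passage to congruences *)

Lemma comp_poly_shift_dvd (P : {poly int}) (c : int) :
  exists Q, P \Po ('X + c%:P) = P + c *: Q.
Proof.
elim/poly_ind: P => [|P d [Q IHP]].
  by exists 0; rewrite comp_poly0 scaler0 addr0.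
(* The cofactor of [c] in the expansion of [(P + c *: Q) * ('X + c)]. *)
exists (P + Q * 'X + c *: Q).
rewrite comp_polyD comp_polyM comp_polyX comp_polyC IHP -!mul_polyC; ring.
Qed.

(** For odd [M] the two umbral values are added, and shifting by [3 * M] changes the value only by a
    multiple of [M]. *)
Lemma dvdz_umbral_sum (P : {poly int}) M : odd M ->
  (M %| 2 * umbral P - \sum_(0 <= a < 3 * M) alt_legendre3 a * P.[a%:Z])%Z.
Proof.
move=> M_odd; rewrite sum_alt_legendre3 -signr_odd M_odd expr1.
have [Q ->] := comp_poly_shift_dvd P (3 * M)%N.
rewrite linearD linearZ /= PoszM.
apply/dvdzP; exists (- 3 * umbral Q); ring.
Qed.

(** In each block of [p] consecutive indices from [p * N] on, only the first is a multiple of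
    [p]. *)
Lemma dvdz_sum_multiples (d : int) (F : nat -> int) p N : (0 < p)%N ->
  (forall a, ~~ (p %| a)%N -> (d %| F a)%Z) ->
  (d %| \sum_(0 <= a < p * N) F a - \sum_(0 <= a < N) F (p * a)%N)%Z.
Proof.
move=> p_gt0 dF; elim: N => [|N IHN]; first by rewrite muln0 !big_geq.
rewrite (@big_cat_nat _ _ _ (p * N)%N) //=; last by rewrite leq_mul.
rewrite [X in _ + X - _]big_ltn; last by rewrite ltn_mul2l p_gt0 ltnSn.
rewrite [X in _ - X]big_nat_recr //=.
set S1 := \sum_(0 <= _ < p * N) _; set S2 := \sum_(0 <= _ < N) _.
rewrite (_ : _ - _ = (S1 - S2) + \sum_((p * N).+1 <= a < p * N.+1) F a);
  last by rewrite /S1 /S2; ring.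
rewrite rpredD // big_nat rpred_sum // => a /andP[lo hi]; apply: dF.
apply/negP => /dvdnP[q aE]; move: lo hi; rewrite aE [(q * p)%N]mulnC.
by rewrite !ltn_mul2l p_gt0 /= ltnS; lia.
Qed.

Lemma fermat_dvdz p a : prime p -> ~~ (p %| a)%N ->
  (p %| 1 - a%:Z ^+ (p - 1))%Z.
Proof.
move=> p_prime pNa; rewrite -rpredN opprB.
have co : coprime a p by rewrite coprime_sym prime_coprime.
have := Euler_exp_totient co; rewrite totient_prime // subn1 => /eqP E.
have a_gt0 : (0 < a)%N by case: (a) pNa; rewrite ?dvdn0.
have : (p %| a ^ p.-1 - 1)%N by rewrite -eqn_mod_dvd // expn_gt0 a_gt0.
rewrite -[(_ %| _)%N]/(p%:Z %| (a ^ p.-1 - 1)%N%:Z)%Z -subzn.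
  by rewrite rmorphXn.
by rewrite expn_gt0 a_gt0.
Qed.

Lemma dvdz_umbral_regular (P : {poly int}) p n : prime p -> odd p ->
  (forall a, ~~ (p %| a)%N -> (p%:Z ^+ n %| P.[a%:Z])%Z) ->
  (p%:Z ^+ n %| umbral P - legendre3 p * umbral (P \Po (p%:Z *: 'X)))%Z.
Proof.
move=> p_prime p_odd dP; have p_gt0 := prime_gt0 p_prime.
set Q := P \Po _; set d := p%:Z ^+ n.
have dE : d = (p ^ n)%N by rewrite /d -rmorphXn.
have co2 : coprimez d 2.
  by rewrite dE coprimezE !absz_nat coprimeXl // coprimen2.
(* As [d] is odd, the difference may be doubled, which suits [dvdz_umbral_sum]. *)
rewrite -(Gauss_dvdzr _ co2).
have M_odd : odd (p ^ n) by rewrite oddX p_odd orbT.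
have pM_odd : odd (p * p ^ n) by rewrite oddM p_odd.
have dP1 : (d %| 2 * umbral P
    - \sum_(0 <= a < p * (3 * p ^ n)) alt_legendre3 a * P.[a%:Z])%Z.
  (* Modulus [p * p ^ n] for [P] against [p ^ n] for [Q] makes the first range exactly [p] times as
     long as the second. *)
  rewrite mulnCA; apply: dvdz_trans (dvdz_umbral_sum P pM_odd).
  by rewrite dE PoszM dvdz_mull.
have dQ := dvdz_umbral_sum Q M_odd; rewrite -dE in dQ.
have dS : (d %| \sum_(0 <= a < p * (3 * p ^ n)) alt_legendre3 a * P.[a%:Z]
   - legendre3 p * \sum_(0 <= a < 3 * p ^ n) alt_legendre3 a * Q.[a%:Z])%Z.
  have -> : legendre3 p * \sum_(0 <= a < 3 * p ^ n) alt_legendre3 a * Q.[a%:Z]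
      = \sum_(0 <= a < 3 * p ^ n) alt_legendre3 (p * a) * P.[(p * a)%N%:Z].
    rewrite mulr_sumr; apply: eq_bigr => a _.
    by rewrite alt_legendre3M // horner_comp hornerZ hornerX PoszM mulrA.
  apply: dvdz_sum_multiples p_gt0 _ => a pNa.
  by rewrite dvdz_mull // dP.
move: dP1 dQ dS; set SP := \sum_(0 <= a < _) _; set SQ := \sum_(0 <= a < _) _.
move=> dP1 dQ dS.
rewrite (_ : 2 * _ = (2 * umbral P - SP) - legendre3 p * (2 * umbral Q - SQ)
   + (SP - legendre3 p * SQ)); last by ring.
by apply: rpredD dS; apply: rpredB dP1 _; apply: dvdz_mull.
Qed.

Lemma intr_Zloc p (m : int) : m%:~R \in Zloc p.
Proof. by rewrite inE denq_int coprime1n. Qed.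

Theorem theorem4p2 (p b : nat) (p_prime : prime p) (p_odd : odd p)
    (b_even : ~~ odd b) :
  p_regular p (fun k : nat =>
    (1 - (legendre3 p)%:~R * p%:R ^+ (k * (p - 1) + b))
      * (U (k * (p - 1) + b))%:~R).
Proof.
pose f k : int := (1 - legendre3 p * p%:Z ^+ (k * (p - 1) + b))
  * U (k * (p - 1) + b).
have fE k : (1 - (legendre3 p)%:~R * p%:R ^+ (k * (p - 1) + b))
    * (U (k * (p - 1) + b))%:~R = (f k)%:~R :> rat.
  by rewrite /f rmorphM rmorphB rmorphM rmorphXn /=.
split=> [k | n _]; first by rewrite fE intr_Zloc.
pose P : {poly int} := 'X^b * (1 - 'X^(p - 1)) ^+ n.
have PE :
    P = \sum_(0 <= k < n.+1) ((-1) ^+ k * 'C(n, k)%:Z) *: 'X^(k * (p - 1) + b).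
  rewrite /P exprDn mulr_sumr big_mkord; apply: eq_bigr => k _.
  rewrite expr1n mul1r [in LHS]exprNn -exprM mulnC exprD -mul_polyC.
  rewrite rmorphM rmorphXn rmorphN1 -natz rmorph_nat -mulr_natr; ring.
have sumE : \sum_(0 <= k < n.+1) 'C(n, k)%:Z * (-1) ^+ k * f k
    = umbral P - legendre3 p * umbral (P \Po (p%:Z *: 'X)).
  rewrite PE linear_sum linear_sum /= linear_sum mulr_sumr -sumrB /=.
  apply: eq_bigr => k _.
  (* Substituting [p * X] scales each monomial by the power of [p] occurring in [f k]. *)
  rewrite comp_polyZ comp_Xn_poly exprZn !linearZ /= umbralXn /f; ring.
have fermatP a : ~~ (p %| a)%N -> (p%:Z ^+ n %| P.[a%:Z])%Z.
  move=> pNa; rewrite /P !hornerE.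
  by rewrite dvdz_mull // dvdz_exp2r // fermat_dvdz.
have /dvdzP[q sum_eq] := dvdz_umbral_regular p_prime p_odd fermatP.
(* The congruence already holds over the integers, so its quotient serves as the witness. *)
exists q%:~R; first exact: intr_Zloc.
rewrite subr0 mulrC -[p%:R]/(p%:Z%:~R) -rmorphXn -rmorphM /= -sum_eq -sumE.
rewrite rmorph_sum /=; apply: eq_bigr => k _.
by rewrite fE !rmorphM rmorphXn rmorphN1.
Qed.
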